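(* Let $A=(A_{lj})_{l,j=1}^m$ be a square matrix with rational entries all of whose eigenvalues are rational, and suppose the minimal polynomial of $A$ has no multiple roots. Let $b$ be the least common denominator of the eigenvalues of $A$. Let $T$ be an invertible matrix with rational entries transforming $A$ to its Jordan normal form, and let $t_1,t_2$ be the least common denominators of the entries of $T$ and $T^{-1}$ respectively. Then the differential operator $$[A]=\sum_{l=1}^m\sum_{j=1}^mA_{lj}\,y_j\frac{\partial}{\partial y_l}$$ satisfies the factorial cancellation condition with constant $t_1t_2\,b\,e^{\chi(b)}$: there exists a sequence of natural numbers $\{\psi_k\}_{k\in\mathbb{N}}$ such that for all $k\in\mathbb{N}$ and $n=0,1,\dots,k$ the operator $\psi_k\frac{1}{n!}\mathcal{A}_n$ maps $\mathbb{Z}[y_1,\dots,y_m]$ into itself, and $\limsup_{k\to\infty}\psi_k^{1/k}\le t_1t_2\,b\,e^{\chi(b)}$.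
   Context: $\mathcal{A}_0$ is the identity operator and, for $n\ge1$, $\mathcal{A}_n=([A]-n+1)\circ([A]-n+2)\circ\cdots\circ([A]-1)\circ[A]$, where $\circ$ is composition of operators on the polynomial ring $\mathbb{Q}[y_1,\dots,y_m]$ and $[A]-c$ denotes $[A]$ minus $c$ times the identity. The least common denominator of a finite set of rationals is the least $d\in\mathbb{N}$ making all of them integers after multiplication by $d$. For $b\in\mathbb{N}$, $\chi(b)=\sum_{p\mid b}\frac{\log p}{p-1}$ over prime divisors $p$ of $b$. *)

(* Defs.v *)
From mathcomp Require Import all_boot all_order all_algebra all_field.
From mathcomp Require Import mpoly.
From mathcomp Require Import reals constructive_ereal sequences exp.

Set Implicit Arguments.
Unset Strict Implicit.
Unset Printing Implicit Defensive.

Import Order.TTheory GRing.Theory Num.Theory.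
Local Open Scope ring_scope.

Section LeastCommonDenominator.

Definition common_denominator (S : rat -> Prop) (d : nat) : Prop :=
  (0 < d)%N /\ (forall x : rat, S x -> d%:R * x \is a Num.int).

Definition is_lcd (S : rat -> Prop) (d : nat) : Prop :=
  common_denominator S d /\
  (forall d' : nat, common_denominator S d' -> (d <= d')%N).

Definition mx_entry (m n : nat) (A : 'M[rat]_(m, n)) (x : rat) : Prop :=
  exists i j, x = A i j.

End LeastCommonDenominator.

Section JordanForm.

Variable F : fieldType.

Definition jordan_block (n : nat) (a : F) : 'M[F]_n :=
  \matrix_(i, j) (a *+ (i == j) + (i.+1 == j :> nat)%:R).

(* The cast only identifies the total size of the blocks with n; blocks of
   size 0 are harmless. *)
Definition is_jordan_normal_form (n : nat) (J : 'M[F]_n) : Prop :=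
  exists (r : nat) (p : 'I_r -> nat) (a : 'I_r -> F)
         (e : (\sum_(i < r) p i)%N = n),
    J = castmx (e, e) (\mxdiag_(i < r) jordan_block (p i) (a i)).

Definition to_jordan_form (n : nat) (T A : 'M[F]_n) : Prop :=
  T \in unitmx /\ is_jordan_normal_form (invmx T *m A *m T).

End JordanForm.

(* Eigenvalues and root multiplicities are taken over the algebraic closure
   algC, so that neither condition presupposes that they are rational. *)
Definition rational_eigenvalues (n : nat) (A : 'M[rat]_n) : Prop :=
  forall z : algC, eigenvalue (map_mx ratr A) z -> z \in Crat.

Definition no_multiple_roots (p : {poly rat}) : Prop :=
  forall z : algC, (mup z (map_poly ratr p) <= 1)%N.

Section Operators.

Variable m : nat.

Definition bracket_op (A : 'M[rat]_m) (p : {mpoly rat[m]}) : {mpoly rat[m]} :=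
  \sum_(l < m) \sum_(j < m) A l j *: ('X_j * p^`M(l)).

(* (D - n + 1) \o ... \o (D - 1) \o D, the factor D being applied first. *)
Fixpoint falling_op (D : {mpoly rat[m]} -> {mpoly rat[m]}) (n : nat) :
    {mpoly rat[m]} -> {mpoly rat[m]} :=
  if n is n'.+1 then (fun p => D p - n'%:R *: p) \o falling_op D n' else id.

Definition preserves_integrality (D : {mpoly rat[m]} -> {mpoly rat[m]}) : Prop :=
  forall p : {mpoly rat[m]},
    p \is a mpolyOver m Num.int -> D p \is a mpolyOver m Num.int.

(* The limsup is taken in the extended reals, so an unbounded sequence has
   limsup +oo; positivity of psi excludes the degenerate choice psi = 0. *)
Definition factorial_cancellation (R : realType)
    (D : {mpoly rat[m]} -> {mpoly rat[m]}) (C : R) : Prop :=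
  exists psi : nat -> nat,
    [/\ forall k, (0 < psi k)%N,
        forall k n, (n <= k)%N ->
          preserves_integrality
            (fun p => ((psi k)%:R / n`!%:R) *: falling_op D n p)
      & (limn_esup (fun k => ((psi k)%:R `^ k%:R^-1 : R)%:E) <= C%:E)%E].

End Operators.

Definition chi (R : realType) (b : nat) : R :=
  \sum_(p <- primes b) ln p%:R / (p%:R - 1).

(* Main.v *)
(* In the eigenvector coordinates z = T^-1 y the derivation [A] is diagonal, so
   (1/n!) A_n multiplies a monomial z^a of eigenvalue mu by binom(mu, n), whose
   denominator divides b^n prod_(p | b) p^floor(n/(p-1)) because b mu is an
   integer. Passing from y to z and back on monomials of degree at most n costs
   a factor (t1 t2)^n. Monomials of higher degree cost nothing more: A_n is a
   differential operator of order at most n, and such an operator is determined,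
   with integer coefficients, by its values on monomials of degree at most n.
   So psi_k = (t1 t2 b)^k prod_(p | b) p^floor(k/(p-1)) works. *)
Require Import Defs.
From HB Require Import structures.
From mathcomp Require Import all_boot all_order all_algebra all_field.
From mathcomp Require Import mpoly.
From mathcomp Require Import classical_sets filter reals constructive_ereal ereal.
From mathcomp Require Import sequences exp.
From mathcomp Require Import ring zify.

Set Implicit Arguments.
Unset Strict Implicit.
Unset Printing Implicit Defensive.

Import Order.TTheory GRing.Theory Num.Theory.
Local Open Scope ring_scope.

(** * Simple roots of the minimal polynomial make the Jordan form diagonal *)

Section JordanDiagonal.

Variable F : fieldType.

(** Row vectors are multiplied on the right and the ones stand above the diagonal, so the last basis
    row is an eigenvector and the one before it is the generalized eigenvector above it. *)
Lemma jordan_block_chain n (a : F) : (1 < n)%N ->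
  exists u v : 'rV[F]_n,
    [/\ v != 0, v *m jordan_block n a = a *: v
      & u *m jordan_block n a = a *: u + v].
Proof.
case: n => [//|[//|n]] _.
exists (delta_mx 0 (inord n)), (delta_mx 0 ord_max); split.
- apply/eqP => /matrixP /(_ 0 ord_max); rewrite !mxE !eqxx /= => /eqP.
  by rewrite oner_eq0.
- rewrite -rowE; apply/rowP => j; rewrite !mxE eqxx /= mulr_natr eq_sym.
  by rewrite (gtn_eqF (ltn_ord j)) addr0.
- rewrite -rowE; apply/rowP => j; rewrite !mxE eqxx /= mulr_natr inordK //.
  by congr (_ *+ _ + _%:R); rewrite eq_sym.
Qed.

Lemma mxdiag_intertwine r (p : 'I_r -> nat) (B : forall i, 'M[F]_(p i)) i :
  exists2 E : 'M[F]_(p i, \sum_(j < r) p j),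
    E *m \mxdiag_(j < r) B j = B i *m E & row_free E.
Proof.
(* [E] includes block [i] into the whole space. [conform_mx] only retypes the identity; its default
   0 is never taken when [i == j]. *)
pose E_ j : 'M[F]_(p i, p j) := if i == j then conform_mx 0 (1%:M : 'M_(p i))
                                else 0.
exists (\mxrow_j E_ j).
  rewrite mul_mxrow_mxdiag mul_mxrow; apply: eq_mxrow => j; rewrite /E_.
  case: eqP => [e|_]; last by rewrite mul0mx mulmx0.
  by case: _ / e; rewrite conform_mx_id mul1mx mulmx1.
apply/row_freeP; exists (\mxcol_j (E_ j)^T).
rewrite mul_mxrow_mxcol (bigD1 i) //= big1 => [|j ne_ji].
  by rewrite /E_ eqxx conform_mx_id trmx1 mulmx1 addr0.
by rewrite /E_ eq_sym (negbTE ne_ji) mul0mx.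
Qed.

Lemma jordan_diag_or_chain n (J : 'M[F]_n) : is_jordan_normal_form J ->
  is_diag_mx J \/
  exists (a : F) (u v : 'rV[F]_n),
    [/\ v != 0, v *m J = a *: v & u *m J = a *: u + v].
Proof.
move=> [r [p [a [e ->]]]]; case: n / e J => _; rewrite castmx_id.
have [small|/forallPn [i]] := boolP [forall i, (p i <= 1)%N].
  left; apply/is_diag_mxblockP; split=> [i j /negbTE -> //|i].
  rewrite eqxx conform_mx_id; apply/is_diag_mxP => k l ne_kl.
  rewrite !mxE; move/forallP/(_ i): small (ltn_ord k) (ltn_ord l) ne_kl.
  by lia.
rewrite -ltnNge => p_gt1; right.
have [E EJ E_free] := mxdiag_intertwine (fun j => jordan_block (p j) (a j)) i.
have [u [v [v_neq0 vJ uJ]]] := jordan_block_chain (a i) p_gt1.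
exists (a i), (u *m E), (v *m E); split.
- by rewrite -(mul0mx _ E) (inj_eq (row_free_inj E_free)).
- by rewrite -mulmxA EJ mulmxA vJ scalemxAl.
- by rewrite -mulmxA EJ mulmxA uJ mulmxDl scalemxAl.
Qed.

(** On the span of [u] and [v] the matrix acts as [a + eps] with [eps^2 = 0], so [q(A)] acts by the
    first-order Taylor expansion of [q] at [a]. A polynomial killing [A] therefore has [a] as a
    double root when [v] is nonzero. *)
Lemma horner_mx_chain n (A : 'M[F]_n.+1) (a : F) (u v : 'rV_n.+1) :
    v *m A = a *: v -> u *m A = a *: u + v -> forall q : {poly F},
  v *m horner_mx A q = q.[a] *: v /\
  u *m horner_mx A q = q.[a] *: u + q^`().[a] *: v.
Proof.
move=> vA uA; elim/poly_ind => [|q c [IHv IHu]].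
  by rewrite deriv0 horner0 rmorph0 !mulmx0 !scale0r addr0.
rewrite !derivE !hornerE rmorphD rmorphM /= horner_mx_X horner_mx_C.
rewrite !mulmxDr !mulmxA IHv IHu !mul_mx_scalar; split.
  by rewrite -scalemxAl vA scalerA scalerDl.
rewrite mulmxDl -!scalemxAl vA uA !scalerDr !scalerA !scalerDl.
by rewrite -!addrA; congr (_ + _); rewrite [RHS]addrC -!addrA.
Qed.

Lemma mxminpoly_chain n (A : 'M[F]_n.+1) (a : F) (u v : 'rV_n.+1) :
    v != 0 -> v *m A = a *: v -> u *m A = a *: u + v ->
  ('X - a%:P) ^+ 2 %| mxminpoly A.
Proof.
move=> v_neq0 vA uA; have [] := horner_mx_chain vA uA (mxminpoly A).
rewrite mx_root_minpoly !mulmx0 => /esym/eqP.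
rewrite scaler_eq0 (negbTE v_neq0) orbF => /eqP pa0.
rewrite pa0 scale0r add0r => /esym/eqP.
rewrite scaler_eq0 (negbTE v_neq0) orbF => /eqP p'a0.
have /factor_theorem [q pE] : root (mxminpoly A) a by apply/eqP.
have /factor_theorem [q' qE] : root q a.
  by move: p'a0; rewrite pE !derivE !hornerE subrr mulr0 add0r => /eqP.
by rewrite pE qE -mulrA -expr2 dvdp_mull.
Qed.

End JordanDiagonal.

Lemma no_multiple_roots_jordan_diag n (A T : 'M[rat]_n.+1) :
    no_multiple_roots (mxminpoly A) -> to_jordan_form T A ->
  is_diag_mx (invmx T *m A *m T).
Proof.
move=> no_mult [T_unit /jordan_diag_or_chain [//|]] [a [u [v [v_neq0 vJ uJ]]]].
(* Right multiplication by [invmx T] carries a chain of the Jordan form to a chain of [A]. *)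
have TK B : B *m (invmx T *m A *m T) *m invmx T = B *m invmx T *m A.
  by rewrite -!mulmxA mulmxV // mulmx1.
have : ('X - a%:P) ^+ 2 %| mxminpoly A.
  apply: (@mxminpoly_chain _ _ _ _ (u *m invmx T) (v *m invmx T)).
  - apply: contraNneq v_neq0 => /(congr1 (mulmx^~ T)).
    by rewrite mulmxKV // mul0mx => ->.
  - by rewrite -TK vJ scalemxAl.
  - by rewrite -TK uJ mulmxDl scalemxAl.
rewrite -(dvdp_map (ratr : {rmorphism rat -> algC})) rmorphXn rmorphB /=.
rewrite map_polyX map_polyC /= => dvd_p.
have := no_mult (ratr a); rewrite leqNgt mup_geq ?dvd_p //.
by rewrite map_poly_eq0 monic_neq0 // mxminpoly_monic.
Qed.

(** * Order of differential operators on polynomials *)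

Section DifferentialOrder.

Variables (K : comNzRingType) (m : nat).
Implicit Types (D G : {mpoly K[m]} -> {mpoly K[m]}) (p q : {mpoly K[m]}).

Definition commX (i : 'I_m) D : {mpoly K[m]} -> {mpoly K[m]} :=
  fun p => D ('X_i * p) - 'X_i * D p.

(* Grothendieck's definition; the bound is strict, so that only [0] has order
   less than [0]. *)
Fixpoint order_lt (n : nat) D : Prop :=
  if n is n'.+1 then forall i, order_lt n' (commX i D) else forall p, D p = 0.

Lemma eq_order_lt n D G : D =1 G -> order_lt n D -> order_lt n G.
Proof.
elim: n D G => [|n IH] D G eqDG; first by move=> D0 p; rewrite -eqDG.
by move=> ord_D i; apply: IH (ord_D i) => p; rewrite /commX !eqDG.
Qed.

Lemma order_lt_add n D G : order_lt n D -> order_lt n G ->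
  order_lt n (fun p => D p + G p).
Proof.
elim: n D G => [|n IH] D G; first by move=> D0 G0 p; rewrite D0 G0 addr0.
move=> ord_D ord_G i; apply: eq_order_lt (IH _ _ (ord_D i) (ord_G i)) => p.
by rewrite /commX; ring.
Qed.

Lemma order_lt_mull n q D : order_lt n D -> order_lt n (fun p => q * D p).
Proof.
elim: n D => [|n IH] D; first by move=> D0 p; rewrite D0 mulr0.
by move=> ord_D i; apply: eq_order_lt (IH _ (ord_D i)) => p; rewrite /commX; ring.
Qed.

(** The hypothesis on commutators says that [D] has order at most one. The induction rests on
    [DG, X_i] = D [G, X_i] + d_i G. *)
Lemma order_lt_comp (D : {additive {mpoly K[m]} -> {mpoly K[m]}})
    (d : 'I_m -> {mpoly K[m]}) n G :
    (forall i p, commX i D p = d i * p) -> order_lt n G ->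
  order_lt n.+1 (D \o G).
Proof.
move=> commD; elim: n G => [|n IH] G ord_G i.
  by move=> p; rewrite /commX /= !ord_G !raddf0 mulr0 subr0.
apply: eq_order_lt (order_lt_add (IH _ (ord_G i)) (order_lt_mull (d i) ord_G)).
by move=> p; rewrite -commD /commX /= raddfB; ring.
Qed.

End DifferentialOrder.

(** * Integrality tested on monomials of low degree *)

Section CoefficientRing.

Variables (K : comNzRingType) (m : nat) (S : subringClosed K).
Implicit Type D : {mpoly K[m]} -> {mpoly K[m]}.

(** Monomials are indexed by lists of variables, so that inductions can remove one variable at a
    time. *)
Definition monom (s : seq 'I_m) : {mpoly K[m]} := \prod_(i <- s) 'X_i.

Lemma mpolyX_monom (a : 'X_{1..m}) : exists s, 'X_[a] = monom s.
Proof.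
rewrite mpolyXE_id; elim: (index_enum _) => [|i r [s IH]].
  by exists [::]; rewrite /monom !big_nil.
exists (nseq (a i) i ++ s); rewrite big_cons IH /monom big_cat; congr (_ * _).
elim: (a i) => [|k IHk]; first by rewrite expr0 big_nil.
by rewrite /= big_cons exprS IHk.
Qed.

(* The induction on [s] uses [D ('X_i * p) = 'X_i * D p + commX i D p], where
   [commX i D] has smaller order. *)
Lemma order_lt_monom_over n D : order_lt n D ->
    (forall s, (size s < n)%N -> D (monom s) \is a mpolyOver m S) ->
  forall s, D (monom s) \is a mpolyOver m S.
Proof.
elim: n D => [|n IH] D ord_D S_D s; first by rewrite ord_D rpred0.
elim: s => [|i s IHs]; first by apply: S_D.
have -> : D (monom (i :: s)) = 'X_i * D (monom s) + commX i D (monom s).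
  by rewrite /commX /monom big_cons; ring.
rewrite rpredD ?rpredM ?mpolyOverX //; apply: IH => [|{IHs} s' lt_s'n].
  exact: ord_D.
rewrite /commX rpredB ?rpredM ?mpolyOverX ?S_D 1?ltnW //.
by have := S_D (i :: s'); rewrite /monom big_cons; apply.
Qed.

Lemma linear_mpolyOver
    (D : {linear {mpoly K[m]} -> {mpoly K[m]}}) :
    (forall s, D (monom s) \is a mpolyOver m S) ->
  forall p, p \is a mpolyOver m S -> D p \is a mpolyOver m S.
Proof.
move=> S_D p /mpolyOverP S_p; rewrite (mpolyE p) linear_sum rpred_sum //.
move=> a _; rewrite linearZ mpolyOverZ //.
by have [s ->] := mpolyX_monom a.
Qed.

End CoefficientRing.

(** * Denominators of binomial coefficients at rational arguments *)

Lemma logn_fact_le p n : prime p -> (logn p n`! <= n %/ p.-1)%N.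
Proof.
move=> p_pr; have p_gt1 := prime_gt1 p_pr.
rewrite leq_divRL; last by lia.
(* Geometric bound for the partial sums of Legendre's formula; the extra term [n %/ p ^ K] lets the
   induction telescope. *)
have step K : (p.-1 * (\sum_(1 <= k < K.+1) n %/ p ^ k) + n %/ p ^ K <= n)%N.
  elim: K => [|K IH]; first by rewrite big_geq // expn0 divn1 muln0.
  rewrite big_nat_recr //= mulnDr; apply: leq_trans IH.
  have := leq_divM (n %/ p ^ K) p.
  rewrite -divnMA -expnSr; move: (n %/ _)%N (n %/ _)%N => x y.
  by case: p p_gt1 {p_pr} => //= p _; lia.
rewrite logn_fact // mulnC; apply: leq_trans (step n); exact: leq_addr.
Qed.

Definition prime_power_bound (b k : nat) : nat :=
  \prod_(p <- primes b) p ^ (k %/ p.-1).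

Lemma partn_fact_dvd b n k : (n <= k)%N ->
  (n`!`_\pi(b) %| prime_power_bound b k)%N.
Proof.
move=> le_nk; apply/dvdn_partP => // p.
rewrite mem_primes => /and3P [p_pr _ p_dvd].
have p_b : p \in \pi(b).
  apply: pnatPpi (part_pnat \pi(b) n`!) _.
  by rewrite mem_primes p_pr part_gt0.
apply: dvdn_trans (partn_dvd _ (fact_gt0 n) (dvdn_part _ _)) _.
rewrite p_part /prime_power_bound (big_rem p) //=.
apply/dvdn_mulr/dvdn_exp2l/(leq_trans (logn_fact_le n p_pr)).
by rewrite leq_div2r.
Qed.

Lemma prod_subz_ffact (x n : nat) :
  \prod_(j < n) (x%:Z - j%:Z) = (x ^_ n)%:Z.
Proof.
elim: n => [|n IH]; first by rewrite big_ord0 ffactn0.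
rewrite big_ord_recr /= IH ffactnSr.
(* Truncated subtraction departs from the integer one only for [x < n], where [x ^_ n] already
   vanishes. *)
case: (ltnP x n) => [/ffact_small ->|le_nx]; first by rewrite !mul0r.
by rewrite PoszM -subzn.
Qed.

(* Modulo [u] the integer [b] is invertible, so that up to a unit the product
   is a falling factorial of a natural number. *)
Lemma coprime_dvd_prod (a : int) (b n u : nat) :
    coprime u b -> (u %| n`!)%N ->
  (u%:Z %| \prod_(j < n) (a - j%:Z * b%:Z))%Z.
Proof.
move=> co_ub u_dvd; have u_gt0 : (0 < u)%N by apply: dvdn_gt0 u_dvd; apply: fact_gt0.
have [c cb] : exists c : int, (u%:Z %| b%:Z * c - 1)%Z.
  have /coprimezP [[x y] /= xy] : coprimez u b by [].
  exists y; apply/dvdzP; exists (- x); lia.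
have co_uc : coprimez u%:Z (c ^+ n).
  apply: coprimezXr; apply/coprimezP; case/dvdzP: cb => q cb.
  by exists (- q, b%:Z) => /=; lia.
rewrite -(Gauss_dvdzr _ co_uc).
(* [x] is a natural number representing [a / b] modulo [u]; its falling factorial is ['C(x, n)]
   times n!, hence a multiple of [u]. *)
set x := `|((a * c) %% u)%Z|%N.
have ac_x : (u%:Z %| a * c - x%:Z)%Z.
  rewrite /x gez0_abs ?modz_ge0 //; last by lia.
  by rewrite {1}(divz_eq (a * c) u) addrK dvdz_mull.
have -> : c ^+ n = \prod_(j < n) c by rewrite prodr_const card_ord.
rewrite -big_split /=.
suff /dvdzP [q /(canRL (subrK _)) ->] : (u%:Z %|
    \prod_(j < n) (c * (a - j%:Z * b%:Z)) - \prod_(j < n) (x%:Z - j%:Z))%Z.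
  apply: rpredD; first exact: dvdz_mull.
  rewrite prod_subz_ffact -bin_ffact.
  exact: (dvdn_mull 'C(x, n) u_dvd).
apply: (big_ind2 (fun y z => (u%:Z %| y - z)%Z)) => [|y z y' z' yz yz'|j _].
- by rewrite subrr dvdz0.
- have -> : y * y' - z * z' = (y - z) * y' + z * (y' - z') by ring.
  by apply: rpredD; [apply: dvdz_mulr|apply: dvdz_mull].
- have -> : c * (a - j%:Z * b%:Z) - (x%:Z - j%:Z)
      = (a * c - x%:Z) - j%:Z * (b%:Z * c - 1) by ring.
  by apply: rpredB => //; apply: dvdz_mull.
Qed.

(** Split n! into its part at the primes of [b], which divides [prime_power_bound b k], and its part
    prime to [b], which divides the product. *)
Lemma fact_dvd_prod (a : int) (b n k : nat) : (0 < b)%N -> (n <= k)%N ->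
  (n`!%:Z %| (prime_power_bound b k)%:Z * \prod_(j < n) (a - j%:Z * b%:Z))%Z.
Proof.
move=> b_gt0 le_nk; rewrite -(partnC \pi(b) (fact_gt0 n)) PoszM.
apply: dvdz_mul; first exact: partn_fact_dvd.
apply: coprime_dvd_prod; last exact: dvdn_part.
rewrite coprime_sym; apply: (@pnat_coprime \pi(b)); last exact: part_pnat.
by apply: pnat_pi.
Qed.

(** * The derivation [A] and its falling factorials *)

Section Bracket.

Variables (m : nat) (A : 'M[rat]_m).
Local Notation D := (bracket_op A).

Lemma bracket_op_is_linear : linear D.
Proof.
move=> c p q; rewrite /bracket_op scaler_sumr -big_split; apply: eq_bigr => l _.
rewrite scaler_sumr -big_split; apply: eq_bigr => j _ /=.
by rewrite linearP mulrDr scalerDr -scalerAr !scalerA mulrC.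
Qed.

HB.instance Definition _ :=
  GRing.isLinear.Build rat {mpoly rat[m]} {mpoly rat[m]} _ D
    bracket_op_is_linear.

Lemma bracket_opM p q : D (p * q) = D p * q + p * D q.
Proof.
rewrite /bracket_op mulr_suml mulr_sumr -big_split; apply: eq_bigr => l _.
rewrite mulr_suml mulr_sumr -big_split; apply: eq_bigr => j _ /=.
by rewrite mderivM -scalerAl -scalerAr -scalerDr; congr (_ *: _); ring.
Qed.

Lemma bracket_opX j : D 'X_j = \sum_k A j k *: 'X_k.
Proof.
have X'_eq l : ('X_j : {mpoly rat[m]})^`M(l) = (l == j)%:R.
  rewrite mderivX mnm1E eq_sym; case: eqP => [->|_]; last by rewrite scale0r.
  by rewrite -[X in (X - _)%MM]add0m addmK mpolyX0 scale1r.
rewrite /bracket_op (bigD1 j) //=.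
rewrite [X in _ + X](_ : _ = 0) ?addr0; last first.
  apply: big1 => l /negbTE ne_lj; apply: big1 => k _.
  by rewrite X'_eq ne_lj mulr0 scaler0.
by apply: eq_bigr => k _; rewrite X'_eq eqxx mulr1.
Qed.

Definition shifted_op (c : rat) (p : {mpoly rat[m]}) := D p - c *: p.

Lemma shifted_op_is_linear c : linear (shifted_op c).
Proof.
move=> a p q; rewrite /shifted_op linearP scalerBr scalerDr !scalerA mulrC.
by rewrite opprD !addrA; congr (_ - _); rewrite -!addrA; congr (_ + _); rewrite addrC.
Qed.

HB.instance Definition _ c :=
  GRing.isLinear.Build rat {mpoly rat[m]} {mpoly rat[m]} _ (shifted_op c)
    (shifted_op_is_linear c).

Lemma falling_op_is_linear n : linear (falling_op D n).
Proof.
by elim: n => [//|n IH] a p q; rewrite /= IH; apply: shifted_op_is_linear.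
Qed.

HB.instance Definition _ n :=
  GRing.isLinear.Build rat {mpoly rat[m]} {mpoly rat[m]} _ (falling_op D n)
    (falling_op_is_linear n).

(** By the Leibniz rule the commutator of each factor with ['X_i] is multiplication by [D 'X_i], so
    each of the [n] factors has order at most one. *)
Lemma order_lt_falling_op n : order_lt n.+1 (falling_op D n).
Proof.
elim: n => [|n IH]; first by move=> i p; rewrite /commX subrr.
apply: (order_lt_comp (D := shifted_op n%:R) (d := fun i => D 'X_i)) IH => i p.
rewrite /commX /= /shifted_op. by rewrite (bracket_opM 'X_i p) mulrBr -scalerAr; ring.
Qed.

Lemma falling_op_eigen (mu : rat) (f : {mpoly rat[m]}) n : D f = mu *: f ->
  falling_op D n f = (\prod_(j < n) (mu - j%:R)) *: f.
Proof.
move=> Df; elim: n => [|n IH]; first by rewrite big_ord0 scale1r.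
by rewrite /= IH linearZ /= Df big_ord_recr /= !scalerA -scalerBl mulrBr [n%:R * _]mulrC.
Qed.

End Bracket.

(* Convertible to [Num.int], whose qualifier form hides its closure properties
   from the [rpred] lemmas when it occurs inside [mpolyOver]. *)
Definition int_subring : subringClosed rat :=
  GRing.SubringClosed.clone rat (fun x => Num.int_num_subdef x) _.

(** With [a = b mu] an integer, distributing [b ^ n] over the product turns each factor [mu - j]
    into [a - j b]. *)
Lemma falling_coef_int (b n k : nat) (mu : rat) :
    (0 < b)%N -> (n <= k)%N -> b%:R * mu \is a Num.int ->
  (prime_power_bound b k)%:R * b%:R ^+ n / n`!%:R * \prod_(j < n) (mu - j%:R)
    \is a Num.int.
Proof.
move=> b_gt0 le_nk /intrP [a b_mu].
have -> : (prime_power_bound b k)%:R * b%:R ^+ n / n`!%:R *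
    \prod_(j < n) (mu - j%:R) =
    ((prime_power_bound b k)%:Z * \prod_(j < n) (a - j%:Z * b%:Z))%:~R
    / n`!%:Z%:~R :> rat.
  rewrite mulrAC; congr (_ / _); rewrite rmorphM /= -mulrA; congr (_ * _).
  rewrite -[n in b%:R ^+ n]card_ord -prodr_const -big_split rmorph_prod.
  by apply: eq_bigr => j _; rewrite /= mulrBr b_mu rmorphB rmorphM /= [b%:R * _]mulrC.
exact/Qint_dvdz/fact_dvd_prod.
Qed.

(** * Integrality through eigenvector coordinates *)

Section DiagonalCoordinates.

Variables (m : nat) (A T : 'M[rat]_m.+1).
Hypotheses (T_unit : T \in unitmx)
           (diag_TA : is_diag_mx (invmx T *m A *m T)).
Local Notation D := (bracket_op A).
Local Notation over_int := (mpolyOver m.+1 int_subring).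

Definition eigen_value i : rat := (invmx T *m A *m T) i i.

Definition eigen_form i : {mpoly rat[m.+1]} := \sum_j invmx T i j *: 'X_j.

(** [D] sends the linear form with coefficient row [v] to the one with row [v *m A], so its
    eigenforms come from left eigenvectors of [A], here the rows of [invmx T]. *)
Lemma row_invmx_eigen i :
  row i (invmx T) *m A = eigen_value i *: row i (invmx T).
Proof.
have /diag_mxP [d TA] := diag_TA.
rewrite /eigen_value TA mxE eqxx mulr1n -row_mul.
rewrite (_ : invmx T *m A = diag_mx d *m invmx T); last first.
  by rewrite -TA -mulmxA mulmxV // mulmx1.
by apply/rowP => j; rewrite mul_diag_mx !mxE.
Qed.

Lemma eigenvalue_eigen_value i : eigenvalue A (eigen_value i).
Proof.
apply/eigenvalueP; exists (row i (invmx T)); first exact: row_invmx_eigen.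
apply: contraTneq isT => row0; have /rowP /(_ i) : row i (invmx T *m T) = 0.
  by rewrite row_mul row0 mul0mx.
by rewrite mulVmx // !mxE eqxx => /eqP; rewrite oner_eq0.
Qed.

Lemma bracket_op_eigen_form i :
  D (eigen_form i) = eigen_value i *: eigen_form i.
Proof.
rewrite /eigen_form linear_sum scaler_sumr.
under eq_bigr => j _ do rewrite linearZ /= bracket_opX scaler_sumr.
rewrite exchange_big; apply: eq_bigr => k _.
under eq_bigr => j _ do rewrite scalerA.
rewrite -scaler_suml scalerA; congr (_ *: _).
have /rowP /(_ k) := row_invmx_eigen i; rewrite !mxE => <-.
by apply: eq_bigr => j _; rewrite !mxE.
Qed.

Lemma mpolyX_eigen_form i : 'X_i = \sum_j T i j *: eigen_form j.
Proof.
under eq_bigr => j _ do rewrite /eigen_form scaler_sumr.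
rewrite exchange_big /= (bigD1 i) //= [X in _ + X](_ : _ = 0).
  under eq_bigr => j _ do rewrite scalerA.
  rewrite addr0 -scaler_suml.
  have := mulmxV T_unit; move/matrixP/(_ i i); rewrite !mxE eqxx => ->.
  by rewrite scale1r.
apply: big1 => k ne_ki; under eq_bigr => j _ do rewrite scalerA.
rewrite -scaler_suml.
have := mulmxV T_unit; move/matrixP/(_ i k).
by rewrite !mxE eq_sym (negbTE ne_ki) => ->; rewrite scale0r.
Qed.

Definition eigen_monom (r : seq 'I_m.+1) := \prod_(i <- r) eigen_form i.

Lemma bracket_op_eigen_monom r :
  D (eigen_monom r) = (\sum_(i <- r) eigen_value i) *: eigen_monom r.
Proof.
rewrite /eigen_monom; elim: r => [|i r IH].
  rewrite !big_nil scale0r /bracket_op big1 // => l _; rewrite big1 // => j _.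
  by rewrite mderivC mulr0 scaler0.
rewrite !big_cons bracket_opM bracket_op_eigen_form IH.
by rewrite -scalerAl -scalerAr -scalerDl.
Qed.

Variables (b t1 t2 : nat).
Hypotheses (b_int : forall x, eigenvalue A x -> b%:R * x \is a Num.int)
           (t1_int : forall i j, t1%:R * T i j \is a Num.int)
           (t2_int : forall i j, t2%:R * invmx T i j \is a Num.int).

Lemma eigen_monom_int r : t2%:R ^+ size r *: eigen_monom r \is a over_int.
Proof.
rewrite /eigen_monom; elim: r => [|i r IH].
  by rewrite big_nil scale1r rpred1.
rewrite big_cons exprS -scalerA scalerAr scalerAl rpredM //.
rewrite /eigen_form scaler_sumr rpred_sum // => j _.
by rewrite scalerA mpolyOverZ ?mpolyOverX //; apply: t2_int.
Qed.

(* Each [X_i] of [s] in turn is expanded in the eigenvectors. *)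
Lemma falling_op_mixed_int n (c : rat) :
    (forall mu, b%:R * mu \is a Num.int ->
       c * \prod_(j < n) (mu - j%:R) \is a Num.int) ->
  forall s r, (t1%:R ^+ size s * t2%:R ^+ (size s + size r) * c)
    *: falling_op D n (monom _ s * eigen_monom r) \is a over_int.
Proof.
move=> c_int; elim=> [|i s IH] r.
  rewrite /monom big_nil mul1r (falling_op_eigen _ (bracket_op_eigen_monom r)).
  rewrite expr0 mul1r add0n scalerA -mulrA mulrC -scalerA.
  rewrite mpolyOverZ ?eigen_monom_int //; apply: c_int.
  rewrite mulr_sumr rpred_sum // => i _; apply: b_int.
  exact: eigenvalue_eigen_value.
have -> : monom _ (i :: s) * eigen_monom r =
    \sum_j T i j *: (monom _ s * eigen_monom (j :: r)).
  rewrite /monom big_cons mpolyX_eigen_form -mulrA mulr_suml.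
  apply: eq_bigr => j _; rewrite -scalerAl; congr (_ *: _).
  by rewrite /eigen_monom big_cons mulrCA.
rewrite linear_sum scaler_sumr rpred_sum // => j _.
rewrite linearZ /= scalerA.
(* Moving one variable from [s] to [r] spends one factor [t1] on [T i j] and leaves the exponent of
   [t2] unchanged. *)
have -> : t1%:R ^+ (size s).+1 * t2%:R ^+ ((size s).+1 + size r) * c * T i j =
    (t1%:R * T i j) * (t1%:R ^+ size s * t2%:R ^+ (size s + (size r).+1) * c).
  by rewrite exprS addnS; ring.
by rewrite -scalerA mpolyOverZ ?IH //; apply: t1_int.
Qed.

(** As the order is at most [n], monomials of degree at most [n] suffice; one of degree [size s]
    needs only the power [size s] of [t1 * t2], and the surplus is an integer. *)
Lemma falling_op_int n (c : rat) :
    (forall mu, b%:R * mu \is a Num.int ->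
       c * \prod_(j < n) (mu - j%:R) \is a Num.int) ->
  preserves_integrality
    (fun p => ((t1 * t2)%:R ^+ n * c) *: falling_op D n p).
Proof.
move=> c_int; set d := _ * c.
apply: (linear_mpolyOver (S := int_subring) (D := d \*: falling_op D n)).
apply: (order_lt_monom_over (n := n.+1)) => [|s].
  apply: eq_order_lt (order_lt_mull d%:MP (order_lt_falling_op A n)) => p.
  by rewrite mul_mpolyC.
rewrite ltnS => le_sn; have := falling_op_mixed_int c_int s [::].
rewrite /eigen_monom big_nil mulr1 addn0 -exprMn -natrM => int_s.
rewrite /= /d -{1}(subnK le_sn) exprD -mulrA -scalerA.
by rewrite mpolyOverZ ?rpredX ?rpred_nat.
Qed.

End DiagonalCoordinates.

(** * Growth of the multipliers and the theorem *)

Lemma prime_power_bound_le (R : realType) b k :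
  (prime_power_bound b k)%:R <= expR (chi R b) ^+ k.
Proof.
rewrite /prime_power_bound /chi expR_sum -prodrXl natr_prod.
rewrite big_seq [leRHS]big_seq; apply: ler_prod => p.
rewrite mem_primes => /andP [p_pr _]; rewrite ler0n /=.
have p_gt0 : 0 < p%:R :> R by rewrite ltr0n prime_gt0.
have p1_gt0 : 0 < p%:R - 1 :> R by rewrite subr_gt0 ltr1n prime_gt1.
have -> : (p ^ (k %/ p.-1))%:R = expR (ln p%:R * (k %/ p.-1)%:R) :> R.
  by rewrite expRM_natr lnK ?posrE // natrX.
rewrite -expRM_natr ler_expR -mulrA ler_wpM2l ?ln_ge0 ?ler1n ?prime_gt0 //.
rewrite ler_pdivlMl // -{1}(prednK (prime_gt0 p_pr)) -natr1 addrK -natrM.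
by rewrite ler_nat mulnC leq_divM.
Qed.

Lemma limn_esup_root_le (R : realType) (psi : nat -> nat) (C : R) :
    1 <= C -> (forall k, (psi k)%:R <= C ^+ k) ->
  (limn_esup (fun k => ((psi k)%:R `^ k%:R^-1 : R)%:E) <= C%:E)%E.
Proof.
move=> C_ge1 psi_le; have C_ge0 : 0 <= C by apply: le_trans C_ge1.
(* The limsup is an infimum of suprema over tails; the crudest one, over all indices, is already at
   most [C]. *)
apply: ereal_inf_le; exists (ereal_sup (range (fun k => ((psi k)%:R `^ k%:R^-1 : R)%:E))).
  by exists setT => //; apply: filterT.
apply: ge_ereal_sup => _ [k _ <-]; rewrite lee_fin.
(* At index 0 the exponent is [0^-1 = 0] and the term is 1, whence the assumption [1 <= C]. *)
case: k => [|k]; first by rewrite invr0 powRr0.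
rewrite [leRHS](_ : C = (C ^+ k.+1) `^ k.+1%:R^-1); last first.
  by rewrite -powR_mulrn // -powRrM divff ?powRr1 // pnatr_eq0.
by apply: ge0_ler_powR; rewrite ?nnegrE ?invr_ge0 ?exprn_ge0.
Qed.

Theorem theorem7 (R : realType) (m : nat) (A T : 'M[rat]_m.+1)
    (b t1 t2 : nat)
    (A_rational_eigenvalues : rational_eigenvalues A)
    (A_minpoly_no_multiple_roots : no_multiple_roots (mxminpoly A))
    (b_lcd : is_lcd (eigenvalue A) b)
    (T_jordan : to_jordan_form T A)
    (t1_lcd : is_lcd (mx_entry T) t1)
    (t2_lcd : is_lcd (mx_entry (invmx T)) t2) :
  factorial_cancellation (bracket_op A)
    (t1%:R * t2%:R * b%:R * expR (chi R b)).
Proof.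
have [[b_gt0 b_int] _] := b_lcd.
have [[t1_gt0 t1_int] _] := t1_lcd.
have [[t2_gt0 t2_int] _] := t2_lcd.
have T_unit := T_jordan.1.
have diag_TA := no_multiple_roots_jordan_diag A_minpoly_no_multiple_roots T_jordan.
have ppb_gt0 k : (0 < prime_power_bound b k)%N.
  rewrite /prime_power_bound big_seq prodn_cond_gt0 // => p.
  by rewrite mem_primes expn_gt0 => /andP [/prime_gt0 ->].
pose psi k := ((t1 * t2 * b) ^ k * prime_power_bound b k)%N.
exists psi; split.
- by move=> k; rewrite muln_gt0 expn_gt0 !muln_gt0 t1_gt0 t2_gt0 b_gt0 ppb_gt0.
- move=> k n le_nk p p_int.
  pose c : rat := (prime_power_bound b k)%:R * b%:R ^+ n / n`!%:R.
  have c_int mu : b%:R * mu \is a Num.int ->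
      c * \prod_(j < n) (mu - j%:R) \is a Num.int.
    exact: falling_coef_int.
  (* Only [n] of the [k] factors [t1 * t2 * b] are needed for the operator of index [n]; the other
     [k - n] form an integer multiplier. *)
  have -> : (psi k)%:R / n`!%:R =
      (t1 * t2)%:R ^+ (k - n) * b%:R ^+ (k - n) * ((t1 * t2)%:R ^+ n * c).
    rewrite /psi natrM natrX [(t1 * t2 * b)%:R]natrM -{1}(subnK le_nk) exprD.
    by rewrite !exprMn /c; ring.
  rewrite -scalerA; apply: (mpolyOverZ (S := int_subring)).
    by rewrite rpredM ?rpredX ?rpred_nat.
  apply: (falling_op_int T_unit diag_TA b_int) p_int => // i j.
    by apply: t1_int; exists i, j.
  by apply: t2_int; exists i, j.
- apply: limn_esup_root_le => [|k].
  + have chi_ge0 : 0 <= chi R b.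
      rewrite /chi big_seq sumr_ge0 // => p; rewrite mem_primes => /andP [p_pr _].
      have p_ge1 : 1 <= p%:R :> R by rewrite ler1n prime_gt0.
      by rewrite divr_ge0 ?ln_ge0 ?subr_ge0.
    rewrite -!natrM mulr_ege1 ?ler1n ?muln_gt0 ?t1_gt0 ?t2_gt0 ?b_gt0 //.
    by rewrite -expR0 ler_expR.
  + rewrite /psi natrM natrX -!natrM exprMn ler_wpM2l ?exprn_ge0 //.
    exact: prime_power_bound_le.
Qed.
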